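(* Let $n\ge 1$ and $d\ge 1$ be integers and let $y\in\mathbb{R}^n$. The function $f_1:\mathbb{R}^n\to\mathbb{R}$ defined by $$f_1(x) := \sum_{i_1,\dots,i_d=1}^n \left|x_{i_1}\cdots x_{i_d} - y_{i_1}\cdots y_{i_d}\right|$$ is a weakly global function; in particular, it has no spurious strict local minima, i.e. every point $x\in\mathbb{R}^n$ that is a strict local minimum of $f_1$ is a global minimum of $f_1$.
   Context: Let $S\subset\mathbb{R}^n$ and $f:S\to\mathbb{R}$, and let $\|\cdot\|_2$ be the Euclidean norm. Points: $x\in S$ is a global minimum of $f$ if $f(x)\le f(y)$ for all $y\in S\setminus\{x\}$. It is a strict local minimum of $f$ if there exists $\epsilon>0$ such that $f(x)<f(y)$ for all $y\in S\setminus\{x\}$ with $\|x-y\|_2\le\epsilon$. Sets: a subset $X\subset S$ is a global minimum of $f$ if $\inf_X f\le \inf_{S\setminus X} f$ (infima in the extended reals, $\inf\emptyset=+\infty$). A nonempty compact subset $X\subset S$ is a strict local minimum of $f$ if there exists $\epsilon>0$ such that for all $x\in X$ and all $y\in S\setminus X$ with $\|x-y\|_2\le\epsilon$, one has $f(x)<f(y)$. Weakly global function: $f:S\to\mathbb{R}$ is weakly global if it is continuous and every (nonempty compact) set that is a strict local minimum of $f$ is a global minimum of $f$ in the sense of sets. *)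

(* Defs.v *)
From mathcomp Require Import all_boot all_order all_algebra.
From mathcomp Require Import all_classical all_reals all_analysis.
Import Order.TTheory GRing.Theory Num.Theory.
Import numFieldNormedType.Exports.

Set Implicit Arguments.
Unset Strict Implicit.
Unset Printing Implicit Defensive.

Local Open Scope classical_set_scope.
Local Open Scope ring_scope.

(* The library's norm on 'rV[R]_n is the sup norm, so the Euclidean one is
   defined explicitly; both induce the topology of 'rV[R]_n used below. *)
Definition norm2 (R : realType) (n : nat) (x : 'rV[R]_n) : R :=
  Num.sqrt (\sum_(i < n) (x ord0 i) ^+ 2).

(* A function f : S -> R is represented by a total function of which only the
   restriction to S matters. *)

Definition global_min_point (R : realType) (n : nat)
    (S : set 'rV[R]_n) (f : 'rV[R]_n -> R) (x : 'rV[R]_n) : Prop :=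
  S x /\ forall y, (S `\ x) y -> f x <= f y.

Definition strict_local_min_point (R : realType) (n : nat)
    (S : set 'rV[R]_n) (f : 'rV[R]_n -> R) (x : 'rV[R]_n) : Prop :=
  S x /\ exists2 eps : R, 0 < eps &
    forall y, (S `\ x) y -> norm2 (x - y) <= eps -> f x < f y.

Definition global_min_set (R : realType) (n : nat)
    (S : set 'rV[R]_n) (f : 'rV[R]_n -> R) (X : set 'rV[R]_n) : Prop :=
  X `<=` S /\
  (ereal_inf [set (f x)%:E | x in X]
     <= ereal_inf [set (f x)%:E | x in S `\` X])%E.

Definition strict_local_min_set (R : realType) (n : nat)
    (S : set 'rV[R]_n) (f : 'rV[R]_n -> R) (X : set 'rV[R]_n) : Prop :=
  [/\ X `<=` S, X !=set0, compact X &
    exists2 eps : R, 0 < eps &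
      forall x y, X x -> (S `\` X) y -> norm2 (x - y) <= eps -> f x < f y].

Definition weakly_global (R : realType) (n : nat)
    (S : set 'rV[R]_n) (f : 'rV[R]_n -> R) : Prop :=
  {within S, continuous f} /\
  forall X : set 'rV[R]_n, strict_local_min_set S f X -> global_min_set S f X.

(* The multi-index (i_1, ..., i_d) in {1..n}^d is a function i from 'I_d to
   'I_n. *)
Definition f1 (R : realType) (n d : nat) (y x : 'rV[R]_n) : R :=
  \sum_(i : {ffun 'I_d -> 'I_n})
    `| \prod_(k < d) x ord0 (i k) - \prod_(k < d) y ord0 (i k) |.

(* Main.v *)
Require Import Defs.
From mathcomp Require Import all_boot all_order all_algebra.
From mathcomp Require Import all_classical all_reals all_analysis.
From mathcomp Require Import fingroup perm ring lra.
Import Order.TTheory GRing.Theory Num.Theory.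
Import numFieldNormedType.Exports.

(** Since [f1 d y >= 0], and the value [0] is attained at [y], it suffices to
    show that any strict local minimum contains a zero of [f := f1 d y].  This
    follows from a lexicographic descent property, [exists_improvement]: if
    [f x > 0], there are points [x'] arbitrarily close to [x] with either
    [f x' < f x], or [f x' <= f x] and [`|x'| < `|x|].  Indeed, let [X] be a
    strict local minimum, and choose [x] in [X] minimizing [f] first and the
    norm second ([compact_lex_min]).  An improvement [x'] of [x] close enough to
    [x] cannot lie outside [X], where the values are larger than [f x], and
    cannot lie in [X] by the choice of [x]; so [f x = 0].

    The descent property is obtained as follows.

    - If [x = 0], moving towards [y] decreases [f]; if [x != 0] and
      [f 0 <= f x], shrinking [x] does not increase [f] and decreases the norm.
      Both are instances of the convexity of [f (s *: x)] in [s ^+ d]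
      ([f1_scale]).

    - Let [F (u_1, .., u_d)] be the loss where the [d] factors of each product
      are taken from [d] independent vectors ([block_loss]).  It is convex in
      each argument, symmetric, and [f x = F (x, .., x)].  If some [v] satisfies
      [F (v, x, .., x) < f x], then moving [x] slightly towards [v] decreases
      [f] ([block_descent]).

    - Otherwise [x] minimizes [v |-> F (v, x, .., x)], and we may assume
      [f x < f 0].  This partial loss is a sum of functions of the single
      coordinates [v_i], and the [i]-th one is [|y_i| * phi (v_i / y_i)] if
      [y_i != 0], for one convex function [phi] that does not depend on [i]; and
      [x_i = 0] if [y_i = 0].  So each ratio [x_i / y_i] minimizes [phi].  If two of them had opposite signs, or one
      vanished, then by convexity [0] would minimize [phi] too; but
      [F (0, x, .., x) = f 0], so this would contradict [f x < f 0].  Hence all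
      ratios have the same sign [e]: [x_i = e * y_i * exp (a_i)]
      ([stationary_same_sign]).

    - Finally replace [a] by [s * a] with [s < 1]: a product of coordinates of
      [x] is [e ^+ d * exp A] times the one of [y], with [A] a sum of [a_i].  If
      [e ^+ d = 1], each term [|exp (s * A) - 1|] decreases unless [A = 0], and
      so does [f] ([f1_exp_curve_even]); if [e ^+ d = -1], all terms are
      at least their values at [0], contradicting [f x < f 0] ([f1_exp_curve_odd]). *)

Set Implicit Arguments.
Unset Strict Implicit.
Unset Printing Implicit Defensive.
Local Open Scope classical_set_scope.
Local Open Scope ring_scope.

(** * The loss with independent factors *)

(** The polarization of [f1]: the [k]-th factor of each product comes from its
    own vector [u k]. *)
Definition block_loss (R : realType) (n d : nat) (y : 'rV[R]_n)
    (u : 'I_d -> 'rV[R]_n) : R :=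
  \sum_(i : {ffun 'I_d -> 'I_n})
    `| \prod_(k < d) u k ord0 (i k) - \prod_(k < d) y ord0 (i k) |.

Definition set_block (T : Type) (d : nat) (u : 'I_d -> T) (j : 'I_d) (a : T) :
    'I_d -> T :=
  fun k => if k == j then a else u k.

Lemma f1_ge0 (R : realType) (n d : nat) (y x : 'rV[R]_n) : 0 <= f1 d y x.
Proof. by apply: sumr_ge0 => i _; exact: normr_ge0. Qed.

Lemma cvg_block_loss (R : realType) (n d : nat) (T : Type) (F : set_system T)
    (y : 'rV[R]_n) (u : T -> 'I_d -> 'rV[R]_n) (w : 'I_d -> 'rV[R]_n) :
  Filter F ->
  (forall k i, u t k ord0 i @[t --> F] --> w k ord0 i) ->
  block_loss y (u t) @[t --> F] --> block_loss y w.
Proof.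
move=> FF uw; apply: cvg_big => [|i _]; first exact: add_continuous.
apply: cvg_norm; apply: cvgB; last exact: cvg_cst.
by apply: cvg_big => [|k _]; [exact: mul_continuous | exact: uw].
Qed.

Lemma continuous_f1 (R : realType) (n d : nat) (y : 'rV[R]_n) :
  continuous (f1 d y).
Proof.
move=> x; apply: (@cvg_block_loss _ _ _ _ (nbhs x) y (fun z _ => z)
  (fun=> x)) => k i.
exact: coord_continuous.
Qed.

Lemma cvg_norm2_sub (R : realType) (n : nat) (T : Type) (F : set_system T)
    (x : 'rV[R]_n) (g : T -> 'rV[R]_n) :
  Filter F ->
  (forall i, g t ord0 i @[t --> F] --> x ord0 i) ->
  norm2 (x - g t) @[t --> F] --> (0 : R).
Proof.
move=> FF gx.
have -> : (0 : R) = Num.sqrt (\sum_(i < n) (x ord0 i - x ord0 i) ^+ 2).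
  by rewrite big1 ?sqrtr0// => i _; rewrite subrr expr0n.
apply: continuous_cvg; first exact: sqrt_continuous.
apply: cvg_big => [|i _]; first exact: add_continuous.
under eq_fun do rewrite !mxE expr2.
rewrite expr2; apply: cvgM; apply: cvgB; by [exact: cvg_cst | exact: gx].
Qed.

(** With the other blocks fixed, each product is linear in block [j]. *)
Lemma block_loss_convex (R : realType) (n d : nat) (y : 'rV[R]_n)
    (u : 'I_d -> 'rV[R]_n) (j : 'I_d) (a b : 'rV[R]_n) (t : R) :
  0 <= t <= 1 ->
  block_loss y (set_block u j (a + t *: (b - a))) <=
  (1 - t) * block_loss y (set_block u j a) + t * block_loss y (set_block u j b).
Proof.
move=> /andP[t0 t1]; rewrite !mulr_sumr -big_split /=; apply: ler_sum => i _.
have E c : \prod_(k < d) set_block u j c k ord0 (i k) =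
    c ord0 (i j) * \prod_(k < d | k != j) u k ord0 (i k).
  rewrite (bigD1 j)//= /set_block eqxx; congr (_ * _).
  by apply: eq_bigr => k /negPf ->.
rewrite !E !mxE; set p := \prod_(_ < d | _) _; set q := \prod_(_ < d) _.
have -> : (a ord0 (i j) + t * (b ord0 (i j) - a ord0 (i j))) * p - q =
    (1 - t) * (a ord0 (i j) * p - q) + t * (b ord0 (i j) * p - q) by ring.
apply: le_trans (ler_normD _ _) _.
by rewrite !normrM (ger0_norm t0) (@ger0_norm _ (1 - t)) ?subr_ge0.
Qed.

(** Permuting the blocks amounts to permuting the entries of the multi-index
    over which the sum ranges. *)
Lemma block_loss_perm (R : realType) (n d : nat) (y : 'rV[R]_n)
    (u : 'I_d -> 'rV[R]_n) (s : {perm 'I_d}) :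
  block_loss y (u \o s) = block_loss y u.
Proof.
pose h (i : {ffun 'I_d -> 'I_n}) := [ffun k => i (s k)].
rewrite /block_loss (reindex h) /=.
  apply: eq_bigr => i _; congr `|_ - _|; rewrite [RHS](reindex_inj (@perm_inj _ s));
  by apply: eq_bigr => k _; rewrite /h ffunE.
exists (fun i => [ffun k => i ((s^-1)%g k)]) => i _; apply/ffunP => k.
  by rewrite !ffunE permKV.
by rewrite !ffunE permK.
Qed.

Lemma block_loss_set_block (R : realType) (n d : nat) (y x v : 'rV[R]_n)
    (j k : 'I_d) :
  block_loss y (set_block (fun=> x) j v) = block_loss y (set_block (fun=> x) k v).
Proof.
rewrite -[RHS](block_loss_perm _ _ (tperm j k)); congr block_loss.
apply/funext => l.
by rewrite /set_block /= -(inj_eq (@perm_inj _ (tperm j k)) l j) tpermL.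
Qed.

Definition ffun_cons (n d : nat) (i : 'I_n) (J : {ffun 'I_d -> 'I_n}) :
    {ffun 'I_d.+1 -> 'I_n} :=
  [ffun k => oapp J i (unlift ord0 k)].

Lemma sum_ffun_cons (R : realType) (n d : nat) (G : {ffun 'I_d.+1 -> 'I_n} -> R) :
  \sum_I G I = \sum_(i < n) \sum_(J : {ffun 'I_d -> 'I_n}) G (ffun_cons i J).
Proof.
rewrite pair_big /= (reindex (fun p => ffun_cons p.1 p.2)) //=.
exists (fun I : {ffun 'I_d.+1 -> 'I_n} =>
   (I ord0, [ffun k => I (lift ord0 k)] : {ffun 'I_d -> 'I_n})).
  move=> [i J] _ /=; rewrite ffunE unlift_none; congr (_, _).
  by apply/ffunP => k; rewrite !ffunE liftK.
move=> I _; apply/ffunP => k; rewrite ffunE /=.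
by case: unliftP => [k' ->|->] //=; rewrite ffunE.
Qed.

Lemma prod_ffun_cons (R : realType) (n d : nat) (u : 'I_d.+1 -> 'rV[R]_n)
    (i : 'I_n) (J : {ffun 'I_d -> 'I_n}) :
  \prod_(k < d.+1) u k ord0 (ffun_cons i J k) =
  u ord0 ord0 i * \prod_(k < d) u (lift ord0 k) ord0 (J k).
Proof.
rewrite big_ord_recl ffunE unlift_none; congr (_ * _).
by apply: eq_bigr => k _; rewrite ffunE liftK.
Qed.

(** The partial loss splits into functions of the single coordinates of [v]:
    the [i]-th inner sum collects the multi-indices that start with [i]. *)
Lemma block_loss_head (R : realType) (n d : nat) (y x v : 'rV[R]_n) :
  block_loss y (set_block (fun=> x) (ord0 : 'I_d.+1) v) =
  \sum_(i < n) \sum_(J : {ffun 'I_d -> 'I_n})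
    `| v ord0 i * \prod_(k < d) x ord0 (J k) -
       y ord0 i * \prod_(k < d) y ord0 (J k) |.
Proof.
rewrite /block_loss sum_ffun_cons; apply: eq_bigr => i _; apply: eq_bigr => J _.
by congr `|_ - _|; [rewrite prod_ffun_cons | exact: (prod_ffun_cons (fun=> y))].
Qed.

Lemma f1_head (R : realType) (n d : nat) (y x : 'rV[R]_n) :
  f1 d.+1 y x = block_loss y (set_block (fun=> x) (ord0 : 'I_d.+1) x).
Proof.
by congr (@block_loss R n d.+1 y); apply/funext => k; rewrite /set_block if_same.
Qed.

Lemma f1_0 (R : realType) (n d : nat) (y : 'rV[R]_n) :
  f1 d.+1 y 0 = \sum_(i : {ffun 'I_d.+1 -> 'I_n}) `|\prod_(k < d.+1) y ord0 (i k)|.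
Proof.
apply: eq_bigr => i _.
by rewrite big_ord_recl mxE mul0r sub0r normrN.
Qed.

Lemma block_loss_0 (R : realType) (n d : nat) (y x : 'rV[R]_n) :
  block_loss y (set_block (fun=> x) (ord0 : 'I_d.+1) 0) = f1 d.+1 y 0.
Proof.
rewrite f1_0 /block_loss; apply: eq_bigr => i _.
by rewrite big_ord_recl /set_block eqxx mxE mul0r sub0r normrN.
Qed.

(** * Descent by varying one block *)

Lemma cvg_segment (R : realType) (n : nat) (x v : 'rV[R]_n) (i : 'I_n) :
  (x + t *: (v - x)) ord0 i @[t --> 0^'+] --> x ord0 i.
Proof.
under eq_fun do rewrite !mxE.
have : x ord0 i + t * (v ord0 i - x ord0 i) @[t --> 0^'+] -->
    x ord0 i + 0 * (v ord0 i - x ord0 i).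
  apply: cvgD; first exact: cvg_cst.
  apply: cvgM; last exact: cvg_cst.
  exact/cvg_at_right_filter/cvg_id.
by rewrite mul0r addr0.
Qed.

(** Replace [x] by [g t := x + t *: (v - x)] in one block after the other.  By
    convexity each replacement changes the loss [A] by at most [t * (B - A)],
    where [B] is the loss with [v] in that block.  As [t] tends to [0], [B - A]
    tends to the difference of the two sides of the hypothesis, which is
    negative; so all [d.+1] replacements decrease the loss when [t] is small. *)
Lemma block_descent (R : realType) (n d : nat) (y x v : 'rV[R]_n) :
  block_loss y (set_block (fun=> x) (ord0 : 'I_d.+1) v) < f1 d.+1 y x ->
  \forall t \near (0 : R)^'+, f1 d.+1 y (x + t *: (v - x)) < f1 d.+1 y x.
Proof.
move=> vx; pose g t := x + t *: (v - x).
(* [u t j]: the blocks before the [j]-th one have already been replaced. *)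
pose u t (j : nat) : 'I_d.+1 -> 'rV[R]_n := fun k => if (k < j)%N then g t else x.
have cu j k i : u t j k ord0 i @[t --> 0^'+] --> x ord0 i.
  by rewrite /u; case: (k < j)%N; [exact: cvg_segment | exact: cvg_cst].
have gap (j : 'I_d.+1) : \forall t \near (0 : R)^'+,
    block_loss y (set_block (u t j) j v) < block_loss y (u t j).
  have c1 : block_loss y (set_block (u t j) j v) @[t --> 0^'+] -->
      block_loss y (set_block (fun=> x) (ord0 : 'I_d.+1) v).
    rewrite (block_loss_set_block y x v ord0 j).
    apply: (@cvg_block_loss _ _ _ _ _ y (fun t => set_block (u t j) j v)
      (set_block (fun=> x) j v)) => k i; rewrite /set_block.
    by case: (k == j); [exact: cvg_cst | exact: cu].
  have c2 : block_loss y (u t j) @[t --> 0^'+] --> f1 d.+1 y x.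
    apply: (@cvg_block_loss _ _ _ _ _ y (fun t => u t j) (fun=> x)) => k i.
    exact: cu.
  have /cvgr_gt/(_ 0) : block_loss y (u t j) - block_loss y (set_block (u t j) j v)
      @[t --> 0^'+] --> f1 d.+1 y x -
        block_loss y (set_block (fun=> x) (ord0 : 'I_d.+1) v) by apply: cvgB.
  rewrite subr_gt0 => /(_ vx); apply: filterS => t.
  by rewrite subr_gt0.
have gaps := filter_forall _ gap.
near=> t.
have t0 : 0 < t by near: t; exact: nbhs_right_gt.
have t1 : t <= 1 by near: t; apply: nbhs_right_le; exact: ltr01.
have gap_t : forall j : 'I_d.+1,
    block_loss y (set_block (u t j) j v) < block_loss y (u t j).
  by near: t; exact: gaps.
have step (j : 'I_d.+1) : block_loss y (u t j.+1) < block_loss y (u t j).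
  have -> : u t j.+1 = set_block (u t j) j (g t).
    by apply/funext => k; rewrite /u /set_block ltnS leq_eqVlt val_eqE;
      case: (k == j).
  have uj : set_block (u t j) j x = u t j.
    by apply/funext => k; rewrite /u /set_block; case: eqP => // ->; rewrite ltnn.
  have t01 : 0 <= t <= 1 by rewrite ltW.
  apply: le_lt_trans (block_loss_convex y (u t j) j x v t01) _.
  by rewrite uj; have := gap_t j; nra.
have all_steps j : (j < d.+1)%N -> block_loss y (u t j.+1) < block_loss y (u t 0%N).
  elim: j => [|j IH] jd; first exact: (step (Ordinal jd)).
  exact: lt_trans (step (Ordinal jd)) (IH (ltnW jd)).
have -> : f1 d.+1 y x = block_loss y (u t 0%N) by [].
have -> : f1 d.+1 y (g t) = block_loss y (u t d.+1); last exact: all_steps.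
by congr (@block_loss R n d.+1 y); apply/funext => k; rewrite /u ltn_ord.
Unshelve. all: by end_near. Qed.

(** The key rigidity: a minimizer of the partial loss at a level below [f1 0]
    lies in the open orthant of [y] or of [- y] (up to the coordinates where
    [y] vanishes).  Setting the varying block to [0] gives the value [f1 0]
    whatever the other blocks are; this is what excludes ratios [x_i / y_i] of
    different signs. *)
Lemma stationary_same_sign (R : realType) (n d : nat) (y x : 'rV[R]_n) :
  (forall v, f1 d.+1 y x <= block_loss y (set_block (fun=> x) (ord0 : 'I_d.+1) v)) ->
  f1 d.+1 y x < f1 d.+1 y 0 ->
  exists (e : R) (a : 'I_n -> R),
    (e = 1 \/ e = -1) /\ forall i, x ord0 i = e * y ord0 i * expR (a i).
Proof.
move=> xmin x0.
pose X (J : {ffun 'I_d -> 'I_n}) := \prod_(k < d) x ord0 (J k).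
pose Y (J : {ffun 'I_d -> 'I_n}) := \prod_(k < d) y ord0 (J k).
pose phi (s : R) : R := \sum_J `|s * X J - Y J|.
have f1x : f1 d.+1 y x = \sum_i \sum_J `|x ord0 i * X J - y ord0 i * Y J|.
  by rewrite f1_head block_loss_head.
have f10 : f1 d.+1 y 0 = \sum_i \sum_J `|0 * X J - y ord0 i * Y J|.
  by rewrite -(block_loss_0 d y x) block_loss_head; under eq_bigr do rewrite mxE.
have coord_min i s : \sum_J `|x ord0 i * X J - y ord0 i * Y J| <=
    \sum_J `|s * X J - y ord0 i * Y J|.
  have := xmin (\row_j if j == i then s else x ord0 j).
  rewrite f1x block_loss_head (bigD1 i)//= [leRHS](bigD1 i)//= mxE eqxx.
  rewrite [X in _ <= _ + X](eq_bigr (fun j =>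
    \sum_J `|x ord0 j * X J - y ord0 j * Y J|)) ?lerD2r// => j /negPf ji.
  by apply: eq_bigr => J _; rewrite mxE ji.
have scale i s : y ord0 i != 0 ->
    \sum_J `|s * X J - y ord0 i * Y J| = `|y ord0 i| * phi (s / y ord0 i).
  move=> yi; rewrite mulr_sumr; apply: eq_bigr => J _; rewrite -normrM.
  by congr `|_|; field.
have phi_min i s : y ord0 i != 0 -> phi (x ord0 i / y ord0 i) <= phi s.
  move=> yi; have := coord_min i (s * y ord0 i).
  by rewrite !scale// ler_pM2l ?normr_gt0// mulfK.
have phi0_lt i : y ord0 i != 0 -> phi (x ord0 i / y ord0 i) < phi 0.
  move=> yi; rewrite lt_neqAle phi_min// andbT; apply: contraTneq x0 => phi0.
  rewrite -leNgt f10 f1x; apply: ler_sum => j _.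
  have [yj|yj] := eqVneq (y ord0 j) 0.
    apply: ler_sum => J _.
    by rewrite yj !mul0r !subr0 normr0.
  by rewrite !scale// ler_wpM2l// mul0r -phi0; exact: phi_min.
have no_crossing i j : y ord0 i != 0 -> y ord0 j != 0 ->
    x ord0 i / y ord0 i <= 0 -> 0 <= x ord0 j / y ord0 j -> False.
  move=> yi yj; set a := _ / _; set b := _ / _ => a0 b0.
  have ab : phi a = phi b by apply: le_anti; rewrite !phi_min.
  have pa : phi a < phi 0 := phi0_lt i yi.
  clearbody a b.
  (* Convexity of [phi] on the segment from [a] to [b], which contains [0],
     without denominators. *)
  have : (b - a) * phi 0 <= b * phi a + - a * phi b.
    rewrite !mulr_sumr -big_split /=; apply: ler_sum => J _.
    have ba : 0 <= b - a by lra.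
    have na : 0 <= - a by lra.
    have := ler_normD (b * (a * X J - Y J)) (- a * (b * X J - Y J)).
    have <- : (b - a) * (0 * X J - Y J) =
      b * (a * X J - Y J) + - a * (b * X J - Y J) by ring.
    by rewrite !normrM (ger0_norm ba) (ger0_norm b0) (ger0_norm na).
  rewrite -ab.
  have [b_eq|b_neq] := eqVneq a b.
    have a00 : a = 0 by lra.
    by rewrite a00 ltxx in pa.
  have ba : 0 < b - a by rewrite subr_gt0 lt_neqAle b_neq; lra.
  have -> : b * phi a + - a * phi a = (b - a) * phi a by ring.
  by rewrite ler_pM2l// leNgt pa.
have x_vanish i : y ord0 i = 0 -> x ord0 i = 0.
  move=> yi; have := coord_min i 0.
  have -> : \sum_J `|0 * X J - y ord0 i * Y J| = 0.
    by apply: big1 => J _; rewrite yi !mul0r subr0 normr0.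
  move=> h; apply/eqP; apply: contraTT x0 => xi; rewrite -leNgt f10 f1x.
  have X0 J : X J = 0.
    move: h; under eq_bigr do rewrite yi mul0r subr0.
    rewrite le_eqVlt ltNge sumr_ge0 // orbF psumr_eq0// => /allP /(_ J).
    rewrite mem_index_enum => /(_ isT); rewrite normr_eq0 mulf_eq0 (negPf xi).
    by move/eqP.
  by apply: ler_sum => j _; apply: ler_sum => J _; rewrite X0 !mulr0.
have sgn : exists2 e : R, e = 1 \/ e = -1 &
    forall i, y ord0 i != 0 -> 0 < e * (x ord0 i / y ord0 i).
  have [/existsP[i /andP[yi xi]]|/existsPn none] :=
      boolP [exists i, (y ord0 i != 0) && (0 < x ord0 i / y ord0 i)].
    exists 1; first by left.
    move=> j yj; rewrite mul1r ltNge; apply/negP => xj.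
    exact: (no_crossing j i yj yi xj (ltW xi)).
  exists (-1); first by right.
  move=> j yj; rewrite mulN1r oppr_gt0 ltNge; apply/negP => xj.
  have := none j; rewrite yj /= -leNgt => xj'.
  exact: (no_crossing j j yj yj xj' xj).
case: sgn => e e1 pos.
exists e, (fun i => ln (e * (x ord0 i / y ord0 i))); split => // i.
have [yi|yi] := eqVneq (y ord0 i) 0; first by rewrite x_vanish// yi mulr0 mul0r.
rewrite lnK; last by rewrite posrE pos.
have ee : e * e = 1 by case: e1 => ->; rewrite ?mulrNN mulr1.
transitivity (e * e * x ord0 i); first by rewrite ee mul1r.
by field.
Qed.

(** * Contraction in logarithmic coordinates *)

(** At [e = 1] or [e = -1] and [s = 0] the curve passes through the global
    minimum [y] or through [- y]. *)
Definition exp_curve (R : realType) (n : nat) (y : 'rV[R]_n) (e : R)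
    (a : 'I_n -> R) (s : R) : 'rV[R]_n :=
  \row_i (e * y ord0 i * expR (s * a i)).

Lemma prod_exp_curve (R : realType) (n d : nat) (y : 'rV[R]_n) (e : R)
    (a : 'I_n -> R) (s : R) (i : {ffun 'I_d -> 'I_n}) :
  \prod_(k < d) exp_curve y e a s ord0 (i k) =
  e ^+ d * \prod_(k < d) y ord0 (i k) * expR (s * \sum_(k < d) a (i k)).
Proof.
under eq_bigr do rewrite /exp_curve mxE.
by rewrite mulr_sumr expR_sum !big_split /= prodr_const card_ord.
Qed.

(** Each product at the point has the sign opposite to that of the product at
    [y], or vanishes with it, so it is at least as far from it as [0] is. *)
Lemma f1_exp_curve_odd (R : realType) (n d : nat) (y : 'rV[R]_n) (e : R)
    (a : 'I_n -> R) (s : R) :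
  e ^+ d.+1 = -1 -> f1 d.+1 y 0 <= f1 d.+1 y (exp_curve y e a s).
Proof.
move=> ed; rewrite f1_0; apply: ler_sum => i _.
rewrite prod_exp_curve ed; set q := \prod_(_ < _) _; set E := expR _.
have -> : -1 * q * E - q = - (q * (E + 1)) by ring.
rewrite normrN normrM ler_peMr// ger0_norm ?addr_ge0 ?expR_ge0//.
by rewrite lerDr expR_ge0.
Qed.

(** [expR] is increasing and [s * a] lies between [0] and [a], closer to [0]
    than [a] is. *)
Lemma expR_contraction (R : realType) (s a : R) : 0 <= s < 1 ->
  `|expR (s * a) - 1| <= `|expR a - 1| ?= iff (a == 0).
Proof.
move=> /andP[s0 s1]; apply/leifP; case: eqVneq => [->|a0]; first by rewrite mulr0.
have [a_neg|a_pos|a_eq] := ltgtP a 0; last by rewrite a_eq eqxx in a0.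
- have e1 : expR a < expR (s * a) by rewrite ltr_expR; nra.
  have e2 : expR (s * a) <= 1 by rewrite expR_le1; nra.
  by rewrite !ler0_norm; lra.
- have e1 : expR (s * a) < expR a by rewrite ltr_expR; nra.
  have e2 : 1 <= expR (s * a) by rewrite -expR0 ler_expR; nra.
  by rewrite !ger0_norm; lra.
Qed.

(** Every term shrinks, strictly so unless it vanishes at both points; by the
    positivity hypothesis some term does not vanish. *)
Lemma f1_exp_curve_even (R : realType) (n d : nat) (y : 'rV[R]_n) (e : R)
    (a : 'I_n -> R) (s : R) :
  e ^+ d = 1 -> 0 <= s < 1 -> 0 < f1 d y (exp_curve y e a 1) ->
  f1 d y (exp_curve y e a s) < f1 d y (exp_curve y e a 1).
Proof.
move=> ed s01 pos.
have term (r : R) (i : {ffun 'I_d -> 'I_n}) :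
    `|\prod_(k < d) exp_curve y e a r ord0 (i k) - \prod_(k < d) y ord0 (i k)| =
    `|\prod_(k < d) y ord0 (i k)| * `|expR (r * \sum_(k < d) a (i k)) - 1|.
  by rewrite prod_exp_curve ed -normrM; congr `|_|; ring.
have le_term i := (expR_contraction (\sum_(k < d) a (i k)) s01 : _ <= _ ?= iff _).
rewrite lt_neqAle; apply/andP; split; last first.
  apply: ler_sum => i _; rewrite !term ler_wpM2l// mul1r; exact: (leif_le (le_term i)).
apply: contraTneq pos => eq_f1; rewrite -leNgt.
have : \sum_(i : {ffun 'I_d -> 'I_n})
    (`|\prod_(k < d) exp_curve y e a 1 ord0 (i k) - \prod_(k < d) y ord0 (i k)| -
     `|\prod_(k < d) exp_curve y e a s ord0 (i k) - \prod_(k < d) y ord0 (i k)|) == 0.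
  by rewrite sumrB subr_eq0 -[X in X == _]eq_f1.
rewrite psumr_eq0; last first.
  move=> i _; rewrite !term subr_ge0 ler_wpM2l// mul1r.
  exact: (leif_le (le_term i)).
move=> /allP eq_term; rewrite /f1 big1// => i _.
have := eq_term i; rewrite mem_index_enum => /(_ isT) /=.
rewrite !term -mulrBr mulf_eq0 => /orP[/eqP ->|]; first by rewrite mul0r.
rewrite mul1r subr_eq0 eq_sym (eq_leif (le_term i)) => /eqP ->.
by rewrite expR0 subrr normr0 mulr0.
Qed.

(** * Lexicographic descent and conclusion *)

(** The norm breaks ties: at level [f1 0] the function may be constant along the
    segment from [x] to [0], and progress on it is measured by the norm. *)
Definition improves (R : realType) (n : nat) (f : 'rV[R]_n -> R)
    (x x' : 'rV[R]_n) : Prop :=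
  f x' < f x \/ f x' <= f x /\ `|x'| < `|x|.

(** Scaling [x] by [s] scales every product by [s ^+ d.+1], and each term is
    convex in that factor. *)
Lemma f1_scale (R : realType) (n d : nat) (y x : 'rV[R]_n) (s : R) :
  0 <= s <= 1 ->
  f1 d.+1 y (s *: x) <= (1 - s ^+ d.+1) * f1 d.+1 y 0 + s ^+ d.+1 * f1 d.+1 y x.
Proof.
move=> /andP[s0 s1].
have p0 : 0 <= s ^+ d.+1 by exact: exprn_ge0.
have p1 : 0 <= 1 - s ^+ d.+1 by rewrite subr_ge0 exprn_ile1.
rewrite f1_0 !mulr_sumr -big_split /=; apply: ler_sum => i _.
under [in leLHS]eq_bigr do rewrite mxE.
rewrite big_split /= prodr_const card_ord.
set q := \prod_(_ < _) y _ _; set p := \prod_(_ < _) _.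
have := ler_normD ((1 - s ^+ d.+1) * - q) (s ^+ d.+1 * (p - q)).
rewrite !normrM normrN (ger0_norm p0) (ger0_norm p1).
by have <- : s ^+ d.+1 * p - q =
  (1 - s ^+ d.+1) * - q + s ^+ d.+1 * (p - q) by ring.
Qed.

Lemma near_curve_improves (R : realType) (n : nat) (f : 'rV[R]_n -> R)
    (x : 'rV[R]_n) (g : R -> 'rV[R]_n) (eps : R) :
  0 < eps ->
  (forall i, g t ord0 i @[t --> 0^'+] --> x ord0 i) ->
  (\forall t \near (0 : R)^'+, improves f x (g t)) ->
  exists x', norm2 (x - x') <= eps /\ improves f x x'.
Proof.
move=> e0 gx imp.
have /cvgr_le/(_ eps e0) close := cvg_norm2_sub (at_right_proper_filter 0) gx.
by have [t [? ?]] := filter_ex (filterI close imp); exists (g t).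
Qed.

(** The four cases are [x = 0], [f1 0 <= f1 x], the existence of a better block
    [v], and the remaining points, which lie on a curve [exp_curve]. *)
Lemma exists_improvement (R : realType) (n d : nat) (y x : 'rV[R]_n) (eps : R) :
  0 < eps -> 0 < f1 d.+1 y x ->
  exists x', norm2 (x - x') <= eps /\ improves (f1 d.+1 y) x x'.
Proof.
move=> e0 fx.
have near01 : \forall t \near (0 : R)^'+, 0 < t < 1.
  near=> t; apply/andP; split; near: t; first exact: nbhs_right_gt.
  exact: nbhs_right_lt.
have [x0|x_neq0] := eqVneq x 0.
  apply: (near_curve_improves e0 (@cvg_segment _ _ x y)).
  apply: filterS near01 => t /andP[t0 t1]; left; rewrite x0 add0r subr0.
  have t01 : 0 <= t <= 1 by rewrite !ltW.
  apply: le_lt_trans (f1_scale d y y t01) _.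
  have -> : f1 d.+1 y y = 0 by apply: big1 => i _; rewrite subrr normr0.
  have : 0 < t ^+ d.+1 by exact: exprn_gt0.
  by rewrite x0 in fx; rewrite mulr0 addr0; nra.
have [f0x|fx0] := leP (f1 d.+1 y 0) (f1 d.+1 y x).
  apply: (near_curve_improves e0 (@cvg_segment _ _ x 0)).
  apply: filterS near01 => t /andP[t0 t1]; right.
  have -> : x + t *: (0 - x) = (1 - t) *: x.
    by rewrite sub0r scalerN scalerBl scale1r.
  have t01 : 0 <= 1 - t <= 1 by apply/andP; split; lra.
  split.
    apply: le_trans (f1_scale d y x t01) _.
    have p1 : 0 <= 1 - (1 - t) ^+ d.+1.
      by case/andP: t01 => *; rewrite subr_ge0 exprn_ile1.
    nra.
  have xpos : 0 < `|x| by rewrite normr_gt0.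
  rewrite normrZ ger0_norm; first nra.
  by case/andP: t01.
have [[v vx]|nov] := pselect (exists v,
    block_loss y (set_block (fun=> x) (ord0 : 'I_d.+1) v) < f1 d.+1 y x).
  apply: (near_curve_improves e0 (@cvg_segment _ _ x v)).
  by apply: filterS (block_descent vx) => t; left.
have xmin v : f1 d.+1 y x <= block_loss y (set_block (fun=> x) (ord0 : 'I_d.+1) v).
  by rewrite leNgt; apply/negP => vx; apply: nov; exists v.
have [e [a [e1 xE]]] := stationary_same_sign xmin fx0.
have xC : x = exp_curve y e a 1.
  by apply/rowP => i; rewrite mxE mul1r; exact: xE.
have [ed|ed] : e ^+ d.+1 = 1 \/ e ^+ d.+1 = -1.
  case: e1 => ->; first by left; rewrite expr1n.
  by rewrite -signr_odd; case: odd; [right|left].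
- apply: (@near_curve_improves _ _ _ _ (fun t => exp_curve y e a (1 - t)) _ e0) => [i|].
    rewrite xC mxE; under eq_fun do rewrite mxE.
    apply: cvgM; first exact: cvg_cst.
    apply: continuous_cvg; first exact: continuous_expR.
    apply: cvgM; last exact: cvg_cst.
    have : 1 - t @[t --> (0 : R)^'+] --> (1 - 0 : R).
      apply: cvgB; first exact: cvg_cst.
      exact/cvg_at_right_filter/cvg_id.
    by rewrite subr0.
  apply: filterS near01 => t /andP[t0 t1]; left; rewrite xC.
  apply: f1_exp_curve_even => //; last by rewrite -xC.
  by apply/andP; split; lra.
- by have := f1_exp_curve_odd y a 1 ed; rewrite -xC leNgt fx0.
Unshelve. all: by end_near. Qed.

(** Minimize [f] on [X], then the norm on the compact set of minimizers. *)
Lemma compact_lex_min (R : realType) (n : nat) (f : 'rV[R]_n -> R)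
    (X : set 'rV[R]_n) :
  continuous f -> X !=set0 -> compact X ->
  exists2 x, X x & forall x', X x' -> ~ improves f x x'.
Proof.
move=> fC X0 cX.
have [c /set_mem Xc cmin] := compact_EVT_min X0 cX (continuous_subspaceT fC).
have cM : compact (X `&` [set z | f z = f c]).
  apply: compact_closedI => //.
  exact: (preimage_closed (fun z _ => fC z) (@closed_eq R (f c))).
have M0 : X `&` [set z | f z = f c] !=set0 by exists c.
have nC : continuous (fun z : 'rV[R]_n => `|z|) by exact: norm_continuous.
have [x /set_mem [Xx fx] xmin] := compact_EVT_min M0 cM (continuous_subspaceT nC).
exists x => // x' Xx'; have cx' : f c <= f x' by apply: cmin; exact: mem_set.
case=> [|[le_f lt_n]]; first by rewrite fx ltNge cx'.
have : `|x| <= `|x'|.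
  by apply: xmin; apply: mem_set; split=> //; apply: le_anti; rewrite cx' -fx le_f.
by rewrite leNgt lt_n.
Qed.

Theorem proposition3p1 (R : realType) (n d : nat) (hn : (1 <= n)%N)
    (hd : (1 <= d)%N) (y : 'rV[R]_n) :
  weakly_global [set: 'rV[R]_n] (f1 d y) /\
  forall x : 'rV[R]_n,
    strict_local_min_point [set: 'rV[R]_n] (f1 d y) x ->
    global_min_point [set: 'rV[R]_n] (f1 d y) x.
Proof.
case: d hd => // d _; split; [split|].
- by apply: continuous_subspaceT; exact: continuous_f1.
- move=> X [_ X0 cX [eps e0 Xmin]].
  have [x Xx xmin] := compact_lex_min (@continuous_f1 R n d.+1 y) X0 cX.
  have fx0 : f1 d.+1 y x = 0.
    apply: le_anti; rewrite f1_ge0 andbT leNgt; apply/negP => fx.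
    have [x' [xx' imp]] := exists_improvement e0 fx.
    apply: (xmin x' _ imp); apply: contrapT => Xx'.
    have := Xmin x x' Xx (conj I Xx') xx'.
    by rewrite ltNge; case: imp => [/ltW ->|[->]].
  split=> //; apply: (@le_trans _ _ 0%E).
    by apply: ereal_inf_lbound; exists x => //; rewrite fx0.
  by apply: le_ereal_inf_tmp => _ [z _ <-]; rewrite lee_fin f1_ge0.
- move=> x [_ [eps e0 xmin]]; split=> // z _.
  suff -> : f1 d.+1 y x = 0 by exact: f1_ge0.
  apply: le_anti; rewrite f1_ge0 andbT leNgt; apply/negP => fx.
  have [x' [xx' imp]] := exists_improvement e0 fx.
  have x'x : x' <> x by move=> E; case: imp => [|[_]]; rewrite E ltxx.
  have := xmin x' (conj I x'x) xx'.
  by rewrite ltNge; case: imp => [/ltW ->|[->]].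
Qed.
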